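(* Let $(X,\cdot)$ be a commutative semigroup. Then its operation can be extended uniquely to an operation $\ast$ on $\beta X$ such that: $(\beta X,\ast)$ is a left topological semigroup, the canonical map $\eta:X\to\beta X$ is a morphism of semigroups, and $\mathfrak{m}_x\ast M=M\ast\mathfrak{m}_x$ for all $M\in\beta X$ and $x\in X$. If moreover $e$ is the identity of $X$, then $\mathfrak{m}_e$ is the identity of $\beta X$.
   Context: $\mathcal{P}(X)$ denotes the power set ring of $X$: the set of all subsets of $X$ with addition $A+B=(A\cup B)\setminus(A\cap B)$ and multiplication $A\cdot B=A\cap B$. $\beta X=\operatorname{Spec}\mathcal{P}(X)$ with the Zariski topology, and $\eta:X\to\beta X$ is the map $x\mapsto\mathfrak{m}_x=\mathcal{P}(X\setminus\{x\})$; this is the Stone–Čech compactification of the discrete space $X$. A left topological semigroup is a semigroup $(S,\ast)$ whose underlying set is a topological space such that for each $p\in S$ the map $\ell_p:S\to S$, $x\mapsto p\ast x$, is continuous. *)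

(* Defs.v *)
From HB Require Import structures.
From mathcomp Require Import all_boot all_order all_algebra.
From mathcomp Require Import all_classical all_reals all_analysis.

Set Implicit Arguments.
Unset Strict Implicit.
Unset Printing Implicit Defensive.

Import GRing.Theory.
Local Open Scope classical_set_scope.
Local Open Scope ring_scope.

Definition power_ring (X : Type) : Type := set X.

HB.instance Definition _ (X : Type) := Choice.copy (power_ring X) (set X).

Section PowerRing.
Variable X : Type.
Implicit Types A B C : power_ring X.

Definition power_add A B : power_ring X := (A `|` B) `\` (A `&` B).
Definition power_mul A B : power_ring X := A `&` B.

Ltac set_tauto3 A B C :=
  apply/seteqP; split=> x; rewrite /power_add /power_mul /=;
  have := pselect (A x); have := pselect (B x); have := pselect (C x); tauto.

Lemma power_addA : associative power_add.
Proof. by move=> A B C; set_tauto3 A B C. Qed.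
Lemma power_addC : commutative power_add.
Proof. by move=> A B; set_tauto3 A B B. Qed.
Lemma power_add0 : left_id (set0 : power_ring X) power_add.
Proof. by move=> A; set_tauto3 A A A. Qed.
Lemma power_addN : left_inverse (set0 : power_ring X) id power_add.
Proof. by move=> A; set_tauto3 A A A. Qed.
Lemma power_mulA : associative power_mul.
Proof. by move=> A B C; set_tauto3 A B C. Qed.
Lemma power_mulC : commutative power_mul.
Proof. by move=> A B; set_tauto3 A B B. Qed.
Lemma power_mul1 : left_id (setT : power_ring X) power_mul.
Proof. by move=> A; set_tauto3 A A A. Qed.
Lemma power_mulD : left_distributive power_mul power_add.
Proof. by move=> A B C; set_tauto3 A B C. Qed.

HB.instance Definition _ := GRing.isZmodule.Build (power_ring X)
  power_addA power_addC power_add0 power_addN.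
HB.instance Definition _ := GRing.Zmodule_isComPzRing.Build (power_ring X)
  power_mulA power_mulC power_mul1 power_mulD.

End PowerRing.

(* [prime_idealr] of the library requires a nonzero ring, which would exclude
   the power set ring of the empty set; its spectrum is empty. *)
Record prime_ideal (R : comPzRingType) (P : set R) : Prop := PrimeIdeal {
  prime_ideal0 : P 0;
  prime_idealD : forall a b, P a -> P b -> P (a + b);
  prime_idealMl : forall r a, P a -> P (r * a);
  prime_ideal_proper : ~ P 1;
  prime_idealP : forall a b, P (a * b) -> P a \/ P b
}.

Record spectrum (R : comPzRingType) : Type := Spectrum {
  spec_ideal :> set R;
  spec_prime : prime_ideal spec_ideal
}.

HB.instance Definition _ (R : comPzRingType) := gen_eqMixin (spectrum R).
HB.instance Definition _ (R : comPzRingType) := gen_choiceMixin (spectrum R).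

Section Zariski.
Variable R : comPzRingType.

Definition zero_locus (E : set R) : set (spectrum R) :=
  [set P : spectrum R | E `<=` P].

Definition zariski_open (U : set (spectrum R)) : Prop :=
  exists E : set R, ~` U = zero_locus E.

Lemma zariski_openT : zariski_open setT.
Proof.
exists setT; rewrite setCT; apply/seteqP; split=> // P /(_ 1 I).
by case: P => P [].
Qed.

Lemma zariski_openI : setI_closed zariski_open.
Proof.
move=> U V [E UE] [F VF].
exists [set a * b | a in E & b in F].
rewrite setCI UE VF; apply/seteqP; split=> P.
  case=> EFP _ [a Ea [b Fb <-]]; last first.
    by apply: (prime_idealMl (spec_prime P)); apply: EFP.
  by rewrite mulrC; apply: (prime_idealMl (spec_prime P)); apply: EFP.
move=> EFP; have [|/existsNP[a /not_implyP[Ea nPa]]] := pselect (E `<=` P).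
  by left.
right=> b Fb; have /(prime_idealP (spec_prime P))[//|//] : spec_ideal P (a * b).
  by apply: EFP; exists a => //; exists b.
Qed.

Lemma zariski_open_bigU (I : Type) (f : I -> set (spectrum R)) :
  (forall i, zariski_open (f i)) -> zariski_open (\bigcup_i f i).
Proof.
move=> /choice[E fE]; exists (\bigcup_i E i); rewrite setC_bigcup.
apply/seteqP; split=> [P fP a [i _ Eia]|P EP i _].
  by have := fP i Logic.I; rewrite fE; exact.
by rewrite fE => a Eia; apply: EP; exists i.
Qed.

HB.instance Definition _ := isOpenTopological.Build (spectrum R)
  zariski_openT zariski_openI zariski_open_bigU.

End Zariski.

Definition beta (X : Type) : topologicalType := spectrum (power_ring X).

Definition point_ideal (X : Type) (x : X) : set (power_ring X) :=
  [set A | A `<=` ~` [set x]].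

Lemma point_ideal_prime (X : Type) (x : X) : prime_ideal (point_ideal x).
Proof.
split.
- by move=> y [].
- by move=> A B Ax Bx y [[/Ax|/Bx]].
- by move=> A B Bx y [_ /Bx].
- by move=> /(_ x I) /=; exact.
- move=> A B ABx; have [Ax|nAx] := pselect (A x); last first.
    by left=> y Ay /= yx; apply: nAx; rewrite -yx.
  by right=> y By /= yx; apply: (ABx y) => //; split=> //; rewrite yx.
Qed.

Definition eta (X : Type) (x : X) : beta X := Spectrum (point_ideal_prime x).

Definition left_topological_semigroup (S : topologicalType)
    (op : S -> S -> S) : Prop :=
  associative op /\ forall p : S, continuous (op p).

Definition beta_extension (X : Type) (mul : X -> X -> X)
    (star : beta X -> beta X -> beta X) : Prop :=
  [/\ left_topological_semigroup star,
      {morph @eta X : x y / mul x y >-> star x y}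
    & forall (M : beta X) (x : X), star (eta x) M = star M (eta x)].

(* Main.v *)
Require Import Defs.
From mathcomp Require Import all_boot all_order all_algebra.
From mathcomp Require Import all_classical all_reals all_analysis.

(** Write [A] is [M]-large when [A] is not in the prime ideal [M] of the power
    set ring; the [M]-large sets form an ultrafilter, and every ultrafilter on
    [X] arises in this way.

    Existence.  The requirements leave only one candidate: [A] is
    [star p q]-large iff, for [q]-many [y], the set of those [z] with
    [A (mul z y)] is [p]-large.  So membership in [star p q] amounts to
    membership in [q] of the set [translate_large mul p A], which does not
    depend on [q]; hence the preimage of a zero locus under [star p] is again a
    zero locus, which is continuity ([star_continuous]).  Associativity is the
    associativity of [mul] under three nested quantifiers ([starA]).
    Commutativity of [mul] is what makes the principal points central
    ([star_etaC]), because it makes the two ways of multiplying by [x] have the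
    same preimages.

    Uniqueness.  The principal points are dense in [beta X] and [beta X] is
    Hausdorff, so a continuous self-map is determined by its values at the
    principal points ([eq_continuous_beta]).  This is used twice: first for
    [star (eta y)], whose values at principal points are given by [mul], and
    then for [star p], whose value at [eta y] is [star (eta y) p] by centrality.
    The same principle shows that [star (eta e)] is the identity map when [e]
    is an identity of [mul]. *)

Set Implicit Arguments.
Unset Strict Implicit.
Unset Printing Implicit Defensive.

Local Open Scope classical_set_scope.
Local Open Scope ring_scope.

Section PrimeIdealsOfSets.
Variable X : Type.
Implicit Types (M : beta X) (A B : set X).

Lemma beta_set0 M : spec_ideal M set0.
Proof. exact: prime_ideal0 (spec_prime M). Qed.

Lemma beta_setT M : ~ spec_ideal M setT.
Proof. exact: prime_ideal_proper (spec_prime M). Qed.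

Lemma beta_prime M A B :
  spec_ideal M (A `&` B) -> spec_ideal M A \/ spec_ideal M B.
Proof. exact: (prime_idealP (spec_prime M)). Qed.

Lemma beta_subset M A B : A `<=` B -> spec_ideal M B -> spec_ideal M A.
Proof.
by move=> /setIidl <-; apply: (prime_idealMl (spec_prime M)).
Qed.

Lemma beta_setU M A B :
  spec_ideal M A -> spec_ideal M B -> spec_ideal M (A `|` B).
Proof.
move=> MA MB; have MBA : spec_ideal M (B `\` A).
  by apply: beta_subset MB => x [].
(* On disjoint sets the ring addition is the union. *)
apply: beta_subset (prime_idealD (spec_prime M) MA MBA) => x ABx.
rewrite /GRing.add /= /power_add /=.
by have := pselect (A x); case: ABx; tauto.
Qed.

Lemma beta_setC M A : spec_ideal M (~` A) <-> ~ spec_ideal M A.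
Proof.
split=> [MCA MA|nMA].
  by apply: (@beta_setT M); rewrite -(setUv A); exact: beta_setU.
have [] := @beta_prime M A (~` A); last by [].
- by rewrite setICr; exact: beta_set0.
- by move=> /nMA.
Qed.

Lemma eq_beta (M N : beta X) :
  (forall A, spec_ideal M A <-> spec_ideal N A) -> M = N.
Proof.
case: M N => [I pI] [J pJ] /= IJ.
have {}IJ : I = J by apply/seteqP; split=> A /IJ.
by case: _ / IJ pJ => pJ; rewrite (Prop_irrelevance pI pJ).
Qed.

Lemma spec_ideal_eta (x : X) A : spec_ideal (eta x) A <-> ~ A x.
Proof.
by split=> [Ax /Ax|nAx y Ay /= yx]; [exact | apply: nAx; rewrite -yx].
Qed.

End PrimeIdealsOfSets.

Section BetaTopology.
Variable X : Type.

Definition large_points (A : set X) : set (beta X) :=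
  [set M : beta X | ~ spec_ideal M A].

Lemma large_points_open (A : set X) : open (large_points A).
Proof.
exists [set (A : power_ring X)]; apply/seteqP; split=> M /=.
  by move=> /contrapT MA _ ->.
by move=> MA; apply; exact: MA.
Qed.

(** The sets [large_points A] form a basis, and a large set is nonempty. *)
Lemma dense_eta : dense (range (@eta X)).
Proof.
move=> U [M UM] [E UE].
have : ~ (~` U) M by exact.
rewrite UE => /existsNP[A /not_implyP[EA nMA]].
have /set0P[x Ax] : A != set0.
  by apply/eqP => A0; apply: nMA; rewrite A0; exact: beta_set0.
exists (eta x); split; last by exists x.
apply: contrapT => nUx; have : (~` U) (eta x) by [].
by rewrite UE => /(_ A EA) /spec_ideal_eta.
Qed.

Lemma beta_separated (M N : beta X) : M <> N ->
  exists A : set X, large_points A M /\ large_points (~` A) N.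
Proof.
move=> MN; apply: contrapT => noA; apply: MN; apply: eq_beta => A.
split=> [MA|NA]; apply: contrapT => nA; apply: noA.
  exists (~` A); rewrite setCK; split=> //=.
  by move/beta_setC; exact.
by exists A; split=> //= /beta_setC.
Qed.

(** If [f M] and [g M] were different, a set and its complement would separate
    them, and a principal point of the corresponding neighbourhood of [M] would
    give the same separation where [f] and [g] agree. *)
Lemma eq_continuous_beta (f g : beta X -> beta X) :
  continuous f -> continuous g -> (forall x, f (eta x) = g (eta x)) ->
  f =1 g.
Proof.
move=> /continuousP cf /continuousP cg fg M; apply: contrapT.
move=> /beta_separated[A [fA gA]].
pose U := f @^-1` large_points A `&` g @^-1` large_points (~` A).
have oU : open U.
  by apply: openI; [apply: cf | apply: cg]; exact: large_points_open.
have [] := dense_eta (ex_intro _ M (conj fA gA) : U !=set0) oU.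
move=> N [[fN gN] [x _ xN]]; move: fN gN; rewrite -xN /= -fg.
by move=> fx; apply; apply/beta_setC.
Qed.

End BetaTopology.

Section Star.
Variables (X : Type) (mul : X -> X -> X).
Implicit Types (p q r : beta X) (A B : set X).

Definition translate_large p A : set X :=
  [set y | ~ spec_ideal p [set z | A (mul z y)]].

Lemma translate_large_subset p A B :
  A `<=` B -> translate_large p A `<=` translate_large p B.
Proof.
by move=> AB y pA pB; apply: pA; apply: beta_subset pB => z /AB.
Qed.

Definition star_ideal p q : set (power_ring X) :=
  [set A | spec_ideal q (translate_large p A)].

Lemma star_ideal_prime p q : prime_ideal (star_ideal p q).
Proof.
split.
- apply: beta_subset (beta_set0 q) => y; apply; exact: beta_set0.
- move=> A B qA qB; apply: beta_subset (beta_setU qA qB) => y pAB.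
  apply: contrapT => /not_orP[/contrapT pA /contrapT pB]; apply: pAB.
  by apply: beta_subset (beta_setU pA pB) => z [].
- move=> A B qB; apply: beta_subset qB; apply: translate_large_subset.
  by move=> z [].
- move=> qT; apply: (@beta_setT _ q); apply: beta_subset qT => y _.
  exact: beta_setT.
- move=> A B qAB; apply: beta_prime; apply: beta_subset qAB => y [pA pB].
  by move=> /(@beta_prime _ p [set z | A (mul z y)] [set z | B (mul z y)])[].
Qed.

Definition star p q : beta X := Spectrum (star_ideal_prime p q).

Lemma spec_ideal_star p q A :
  spec_ideal (star p q) A = spec_ideal q (translate_large p A).
Proof. by []. Qed.

(** The map [translate_large p] is chosen before [q], so the preimage under
    [star p] of the zero locus of [E] is the zero locus of the image of [E]. *)
Lemma star_continuous p : continuous (star p).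
Proof.
apply/continuousP => U [E UE]; exists (translate_large p @` E).
rewrite preimage_setC UE; apply/seteqP; split=> q /= qE A.
  by move=> [B EB <-]; exact: qE.
by move=> EA; apply: qE; exists A.
Qed.

(** Both bracketings of [p], [q], [r] test a set along the same nested
    quantifiers: [r]-many [y], then [q]-many [w], then [p]-many [z]. *)
Lemma starA : associative mul -> associative star.
Proof.
move=> mulA p q r; apply: eq_beta => A; rewrite !spec_ideal_star.
suff -> : translate_large q (translate_large p A) =
          translate_large (star p q) A by [].
apply/seteqP; split=> y /= qA; rewrite /translate_large /= => qA'; apply: qA;
  apply: beta_subset qA' => w pA pA'; apply: pA;
  by apply: beta_subset pA' => z /=; rewrite -mulA.
Qed.

Lemma translate_large_eta x A :
  translate_large (eta x) A = [set y | A (mul x y)].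
Proof.
apply/seteqP; split=> y => [/(contra_not (spec_ideal_eta x _).2)/contrapT//|].
by move=> Axy /spec_ideal_eta; apply.
Qed.

Lemma star_eta x y : star (eta x) (eta y) = eta (mul x y).
Proof.
apply: eq_beta => A; rewrite spec_ideal_eta.
by rewrite spec_ideal_star translate_large_eta spec_ideal_eta.
Qed.

Lemma star_etaC : commutative mul ->
  forall p x, star (eta x) p = star p (eta x).
Proof.
move=> mulC p x; apply: eq_beta => A.
rewrite !spec_ideal_star translate_large_eta spec_ideal_eta.
rewrite /translate_large /= notK.
by under [in X in _ <-> X]eq_set do rewrite mulC.
Qed.

Lemma star_beta_extension :
  associative mul -> commutative mul -> beta_extension mul star.
Proof.
move=> mulA mulC; split; [split| |].
- exact: starA.
- exact: star_continuous.
- by move=> x y; rewrite star_eta.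
- by move=> M x; exact: star_etaC.
Qed.

(** Continuity of [s p] reduces the claim to [s p (eta y)], which centrality
    turns into [s (eta y) p]; continuity of [s (eta y)] then reduces it to
    products of principal points. *)
Lemma beta_extension_unique (s t : beta X -> beta X -> beta X) :
  beta_extension mul s -> beta_extension mul t -> s = t.
Proof.
move=> [[_ cs] sM sC] [[_ ct] tM tC].
apply/funext => p; apply/funext.
apply: eq_continuous_beta => [||y]; [exact: cs | exact: ct |].
rewrite -sC -tC; move: p.
apply: eq_continuous_beta => [||z]; [exact: cs | exact: ct |].
by rewrite -sM -tM.
Qed.

Lemma beta_extension_left_id (s : beta X -> beta X -> beta X) (e : X) :
  beta_extension mul s -> left_id e mul -> left_id (eta e) s.
Proof.
move=> [[_ cs] sM _] e1.
apply: (@eq_continuous_beta _ (s (eta e)) id) => [||x]; first exact: cs.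
- by move=> M; exact: cvg_id.
- by rewrite -sM e1.
Qed.

End Star.

Theorem theorem9p1 (X : Type) (mul : X -> X -> X)
    (mulA : associative mul) (mulC : commutative mul) :
  (exists! star : beta X -> beta X -> beta X, beta_extension mul star) /\
  (forall star : beta X -> beta X -> beta X, beta_extension mul star ->
   forall e : X, left_id e mul -> right_id e mul ->
     left_id (eta e) star /\ right_id (eta e) star).
Proof.
have ext := star_beta_extension mulA mulC.
split.
  by exists (star mul); split=> // t; exact: beta_extension_unique.
move=> s sext e e1 _; have s1 := beta_extension_left_id sext e1.
by split=> // M; case: sext => _ _ <-.
Qed.
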